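(* For each positive integer $k$, there exists a finite digraph $D$ with stability number $k$ such that for any $k-1$ directed paths $P_1,\ldots,P_{k-1}$ in $D$, the digraph obtained from $D$ by deleting all vertices of $P_1\cup\cdots\cup P_{k-1}$ has stability number $k$.
   Context: The stability number of a digraph is the maximum size of a set of vertices no two of which are joined by an edge (in either direction). A directed path is a sequence of distinct vertices $v_1,\ldots,v_m$ ($m\ge 1$) with an edge from $v_i$ to $v_{i+1}$ for each $i$. *)

(* Defs.v *)
From mathcomp Require Import all_boot.
Set Implicit Arguments. Unset Strict Implicit. Unset Printing Implicit Defensive.

(* A finite digraph is a finType T with an arc relation e : rel T
   (e x y means an arc from x to y); loops are excluded by requiring
   irreflexive e in the theorem. *)

Definition stableb (T : finType) (e : rel T) (A : {set T}) : bool :=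
  [forall x in A, forall y in A, (x != y) ==> ~~ (e x y || e y x)].

Definition stab_num (T : finType) (e : rel T) (S : {set T}) : nat :=
  \max_(A : {set T} | (A \subset S) && stableb e A) #|A|.

Definition dipath (T : finType) (e : rel T) (p : seq T) : bool :=
  if p is x :: q then path e x q && uniq p else false.

(* Main.v *)
Require Import Defs.
From mathcomp Require Import all_boot.

Set Implicit Arguments. Unset Strict Implicit. Unset Printing Implicit Defensive.

(** Suppose [G] is a graph without [k+1]-clique in which every vertex colouring
    with [k] colours has a monochromatic [k]-clique (Folkman). Consider the
    Cartesian product of [G] with the complete graph on [k] colours, and let [D]
    be an orientation of its complement along a linear order of the vertices of
    [G]. A stable set of [D] is a clique of the product, so it lies in a copy of
    [G] or in a block [{v} x colours] and has at most [k] elements. A directed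
    path meets every block at most once, so [k-1] paths leave a vertex in every
    block; the surviving vertices contain the graph of a colouring of [G], and a
    monochromatic [k]-clique of that colouring is a stable set of size [k].

    Folkman graphs come from a Zykov-type construction. To force a clique of
    size [a i] in some colour [i], take the disjoint union over [i] of graphs
    forcing the sizes [a] with [a i] decreased by one, and add, for each choice
    of one small set in each summand, an apex joined to these sets. In a
    colouring without the required cliques the [i]-th summand has a clique of
    size [a i - 1] in colour [i] for every [i], and the colour of the apex of
    these cliques completes one of them. *)

(** * Folkman graphs by a Zykov-type construction *)

Definition clique (T : finType) (e : rel T) (A : {set T}) : Prop :=
  {in A &, forall x y, x != y -> e x y}.

(** The target sizes vary with the colour so that an induction can lower them one at a time. *)
Definition forces_clique (r : nat) (a : 'I_r -> nat) (T : finType) (e : rel T) :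
  Prop :=
  forall c : T -> 'I_r, exists (i : 'I_r) (A : {set T}),
    [/\ clique e A, {in A, forall x, c x = i} & #|A| = a i].

Section Zykov.

Variables (k r : nat) (T : 'I_r -> finType) (e : forall i, rel (T i)).

Let W : finType := {i : 'I_r & T i}.

Definition sum_edge : rel W :=
  fun u w => (tag u == tag w) && e (tagged u) (tagged_as u w).

(* The bound [< k] keeps apices from creating [k+1]-cliques, without requiring
   [v] to meet the summands in cliques. *)
Definition apex_edge (v : {set W}) (w : W) : bool :=
  (w \in v) && (#|[set u in v | tag u == tag w]| < k).

(** Every subset of the disjoint sum [W] is an apex; no two apices are adjacent, so a clique
    contains at most one. *)
Definition zykov_edge : rel (W + {set W})%type := fun x y =>
  match x, y with
  | inl u, inl w => sum_edge u w
  | inl u, inr v => apex_edge v u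
  | inr v, inl u => apex_edge v u
  | inr _, inr _ => false
  end.

Lemma sum_edge_Tagged i (x y : T i) :
  sum_edge (Tagged T x) (Tagged T y) = e x y.
Proof. by rewrite /sum_edge /= eqxx tagged_asE. Qed.

Lemma Tagged_of_tag i (w : W) : tag w = i -> exists y : T i, w = Tagged T y.
Proof. by case: w => j y /= <-; exists y. Qed.

Lemma sum_edge_tag u w : sum_edge u w -> tag u = tag w.
Proof. by case/andP=> /eqP. Qed.

Lemma zykov_sym : (forall i, symmetric (@e i)) -> symmetric zykov_edge.
Proof.
move=> e_sym [[i x]|v] [[j y]|w] //=.
case: (eqVneq i j) => [eq_ij|ne_ij]; last first.
  by rewrite /sum_edge /= (negPf ne_ij) eq_sym (negPf ne_ij).
by case: j / eq_ij y => y; rewrite !sum_edge_Tagged e_sym.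
Qed.

(** The vertices of a clique other than its apex share a summand: with an apex [v] they lie in a
    part of [v] with fewer than [k] elements, without one they form a clique of some [e i]. *)
Lemma zykov_clique_le (A : {set W + {set W}}) : 0 < k ->
  (forall i (B : {set T i}), clique (@e i) B -> #|B| <= k) ->
  clique zykov_edge A -> #|A| <= k.
Proof.
move=> k_gt0 e_le cA.
have tagA u w : inl u \in A -> inl w \in A -> tag u = tag w.
  move=> uA wA; case: (eqVneq u w) => [-> //|ne_uw].
  by apply: sum_edge_tag; apply: (cA _ _ uA wA).
case: (boolP [exists v, inr v \in A]) => [/existsP[v vA]|noapex].
  rewrite (cardsD1 (inr v)) vA add1n.
  case: (set_0Vmem (A :\ inr v)) => [->|[z]]; first by rewrite cards0.
  have inlA y : y \in A :\ inr v -> exists2 w, y = inl w & apex_edge v w.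
    rewrite in_setD1 => /andP[ne_yv yA].
    have := cA _ _ vA yA; rewrite eq_sym => /(_ ne_yv).
    by case: y {ne_yv yA} => [w|//] /= vw; exists w.
  move=> zA; have [w zE /andP[_ vw]] := inlA _ zA.
  apply: leq_ltn_trans vw; rewrite -(card_imset _ (@inl_inj W {set W})).
  apply/subset_leq_card/subsetP => y yA.
  have [u yE /andP[uv _]] := inlA _ yA.
  rewrite yE; apply: imset_f; rewrite inE uv; apply/eqP/tagA.
    by move: yA; rewrite yE => /setD1P[].
  by move: zA; rewrite zE => /setD1P[].
case: (set_0Vmem A) => [->|[[[i x]|v] xA]]; first by rewrite cards0.
  pose f (y : T i) : W + {set W} := inl (Tagged T y).
  have f_inj : injective f by move=> y y' [] /eqP; rewrite eq_Tagged => /eqP.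
  have -> : A = f @: (f @^-1: A).
    apply/setP=> -[u|v].
    - apply/idP/imsetP => [uA|[y]]; last by rewrite inE => yA ->.
      have [y uE] := Tagged_of_tag (tagA _ _ uA xA).
      by exists y; rewrite ?inE /f -?uE.
    - apply/idP/imsetP => [vA|[y]]; last by rewrite inE => yA ->.
      by case/existsP: noapex; exists v.
  rewrite card_imset //; apply: e_le => y y'; rewrite !inE => yA yA' ne_yy.
  rewrite -sum_edge_Tagged; apply: (cA _ _ yA yA').
  by rewrite (inj_eq f_inj).
by case/existsP: noapex; exists v.
Qed.

Lemma zykov_forces (a : 'I_r -> nat) :
  (forall i, 0 < a i <= k) ->
  (forall i, forces_clique (fun j => a j - (j == i)) (@e i)) ->
  forces_clique a zykov_edge.
Proof.
move=> a_bd e_forces c.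
pose f i (y : T i) : W + {set W} := inl (Tagged T y).
have f_inj i : injective (@f i).
  by move=> y y' [] /eqP; rewrite eq_Tagged => /eqP.
have f_clique i (B : {set T i}) : clique (@e i) B -> clique zykov_edge (@f i @: B).
  move=> cB _ _ /imsetP[x xB ->] /imsetP[y yB ->].
  rewrite (inj_eq (@f_inj i)) => /(cB _ _ xB yB).
  by rewrite /= sum_edge_Tagged.
pose small i (B : {set T i}) :=
  [/\ clique (@e i) B, {in B, forall x, c (f i x) = i} & #|B| = (a i).-1].
pose forced := exists (i : 'I_r) (A : {set W + {set W}}),
  [/\ clique zykov_edge A, {in A, forall x, c x = i} & #|A| = a i].
(* A colour [j != i] keeps its full target, so its clique settles [forced]; colour [i] yields a
   clique one vertex short. *)
have step i : forced \/ exists B, @small i B.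
  have [j [B [cB monoB cardB]]] := e_forces i (c \o @f i).
  case: (eqVneq j i) cardB => [ji|ne_ji] /=; rewrite ?subn1 ?subn0 => cardB.
    right; exists B; split=> [//|x xB|]; last by rewrite cardB ji.
    by rewrite -[RHS]ji; apply: monoB.
  left; exists j, (@f i @: B); split; first exact: f_clique.
    by move=> _ /imsetP[x xB ->]; apply: monoB.
  by rewrite card_imset.
pose good i (B : {set T i}) : bool :=
  [&& [forall x in B, forall y in B, (x != y) ==> e x y],
      [forall x in B, c (f i x) == i] & #|B| == (a i).-1].
have goodP i B : reflect (@small i B) (good i B).
  apply: (iffP and3P) => [[/forall_inP cB /forall_inP mB /eqP]|[cB mB cardB]].
    split=> // [x y xB yB|x xB]; last exact/eqP/mB.
    by move=> ne_xy; have /forall_inP/(_ y yB)/implyP := cB x xB; apply.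
  split; last exact/eqP.
    by apply/forall_inP=> x xB; apply/forall_inP=> y yB; apply/implyP/cB.
  by apply/forall_inP=> x xB; apply/eqP/mB.
case: (boolP [forall i, [exists B, good i B]]) => [/forallP ex|]; last first.
  rewrite negb_forall => /existsP[i noB].
  by case: (step i) => // -[B /goodP gB]; case/existsP: noB; exists B.
pose S i := xchoose (existsP (ex i)).
have SP i : small i (S i) by apply/goodP; apply: (xchooseP (existsP (ex i))).
(* The part of [v] in each summand [i] is [S i], small enough for [apex_edge] because
   [0 < a i <= k]. *)
pose v : {set W} := [set w | tagged w \in S (tag w)].
pose i := c (inr v).
have [cS mS cardS] := SP i.
exists i, (inr v |: @f i @: S i); split.
- have vS y : y \in @f i @: S i -> zykov_edge (inr v) y.
    case/imsetP=> x xS ->; rewrite /= /apex_edge inE /= xS /=.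
    apply: (@leq_ltn_trans #|Tagged T @: S i|); last first.
      apply: leq_ltn_trans (leq_imset_card _ _) _.
      by rewrite cardS; case/andP: (a_bd i) => a_gt0; rewrite prednK.
    apply/subset_leq_card/subsetP => u; rewrite !inE => /andP[uS /eqP tag_u].
    by have [z uE] := Tagged_of_tag tag_u; move: uS; rewrite uE => /(imset_f _).
  have Sv y : y \in @f i @: S i -> zykov_edge y (inr v).
    by move=> yS; move: (vS y yS); case/imsetP: yS => x _ ->.
  move=> x y /setU1P[->|xS] /setU1P[->|yS]; rewrite ?eqxx //.
  + by move=> _; apply: vS.
  + by move=> _; apply: Sv.
  + exact: (f_clique _ _ cS).
- by move=> x /setU1P[-> //|/imsetP[y yS ->]]; apply: mS.
- rewrite cardsU1 card_imset // cardS.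
  have -> : inr v \notin @f i @: S i by apply/imsetP=> -[].
  by rewrite add1n prednK //; case/andP: (a_bd i).
Qed.

End Zykov.

(** Induction on a bound for the sum of the targets. The sigma type lets the graphs obtained for all
    [i] be collected into a family by projection. *)
Lemma folkman_sum (k r n : nat) (a : 'I_r -> nat) :
  0 < k -> 0 < r -> (forall i, a i <= k) -> \sum_i a i <= n ->
  {T : finType & {e : rel T | [/\ symmetric e,
    forall A : {set T}, clique e A -> #|A| <= k & forces_clique a e]}}.
Proof.
move=> k_gt0 r_gt0; elim: n a => [|n IHn] a a_le sum_a.
all: case: (pickP (fun i => a i == 0)) => [i /eqP ai0|a_neq0].
(* A zero target is met by the empty set, so the graph without vertices suffices. *)
1,3: exists void, (fun _ _ => false); split=> [//|A _|c];
  [by apply: leq_trans (max_card _) _; rewrite card_void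
  |by exists i, set0; split=> [x y|x|]; rewrite ?inE ?cards0].
- have := a_neq0 (Ordinal r_gt0).
  by move: sum_a; rewrite leqn0 sum_nat_eq0 => /forallP/(_ (Ordinal r_gt0))/= ->.
have IH i : {T : finType & {e : rel T | [/\ symmetric e,
    forall A : {set T}, clique e A -> #|A| <= k &
    forces_clique (fun j => a j - (j == i)) e]}}.
  apply: IHn => [j|]; first exact: leq_trans (leq_subr _ _) (a_le j).
  rewrite -ltnS; apply: leq_trans sum_a.
  rewrite (bigD1 i) //= [leqRHS](bigD1 i) //= eqxx subn1 -addSn prednK; last first.
    by rewrite lt0n a_neq0.
  by rewrite leq_add2l leq_sum // => j _; apply: leq_subr.
pose T i := projT1 (IH i); pose e i : rel (T i) := sval (projT2 (IH i)).
have eP i := svalP (projT2 (IH i)).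
exists ({i & T i} + {set {i & T i}})%type, (zykov_edge k e); split.
- by apply: zykov_sym => i; case: (eP i).
- by move=> A; apply: zykov_clique_le => // i; case: (eP i).
- apply: zykov_forces => i; last by case: (eP i).
  by rewrite lt0n a_neq0 a_le.
Qed.

(** * The block digraph: stable sets and paths *)

Section BlockDigraph.

Variables (k : nat) (T : finType) (e : rel T).

Definition block_arc : rel (T * 'I_k) := fun x y =>
  (enum_rank x.1 < enum_rank y.1) && ~~ ((x.2 == y.2) && e x.1 y.1).

Lemma block_arc_irr : irreflexive block_arc.
Proof. by move=> x; rewrite /block_arc ltnn. Qed.

(** Vertices of [A] in different blocks share their colour and are adjacent in [e]. Either [A]
    projects injectively to a clique, or it has two colours in one block; a vertex elsewhere would
    need both colours, so [A] stays in that block. *)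
Lemma stable_block_le (A : {set T * 'I_k}) : symmetric e ->
  (forall B : {set T}, clique e B -> #|B| <= k) ->
  stableb block_arc A -> #|A| <= k.
Proof.
move=> e_sym e_le /forall_inP stA.
have adjA x y : x \in A -> y \in A -> x.1 != y.1 -> x.2 = y.2 /\ e x.1 y.1.
  move=> xA yA ne_xy1.
  have ne_xy : x != y by apply: contraNneq ne_xy1 => ->.
  have /forall_inP/(_ y yA)/implyP/(_ ne_xy) := stA x xA.
  rewrite /block_arc [y.2 == _]eq_sym [e y.1 _]e_sym.
  have : enum_rank x.1 != enum_rank y.1 :> nat.
    by rewrite (inj_eq val_inj) (inj_eq enum_rank_inj).
  by rewrite neq_ltn; case/orP=> -> /=; rewrite negb_or !negbK => /andP[];
    do ?[case/andP=> /eqP]; do ?[move=> _ /andP[/eqP]].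
case: (boolP [forall x in A, forall y in A, (x.1 == y.1) ==> (x == y)]).
  move=> /forall_inP inj.
  have inj1 : {in A &, injective fst}.
    move=> x y xA yA /eqP eq1; apply/eqP.
    by have /forall_inP/(_ y yA)/implyP := inj x xA; apply.
  rewrite -(card_in_imset inj1); apply: e_le => _ _ /imsetP[x xA ->] /imsetP[y yA ->].
  by case/(adjA _ _ xA yA).
rewrite negb_forall => /existsP[x]; rewrite negb_imply => /andP[xA].
rewrite negb_forall => /existsP[y]; rewrite !negb_imply.
case/and3P=> yA /eqP eq1 ne_xy.
have ne2 : x.2 != y.2.
  by apply: contraNneq ne_xy => eq2; rewrite [x]surjective_pairing eq1 eq2 -surjective_pairing.
have -> : A = pair x.1 @: (pair x.1 @^-1: A).
  apply/setP=> z; apply/idP/imsetP => [zA|[b]]; last by rewrite inE => ? ->.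
  have eqz : x.1 = z.1.
    apply/eqP; apply: contraNT ne2 => ne1.
    have [-> _] := adjA _ _ xA zA ne1.
    by rewrite eq1 in ne1; have [-> _] := adjA _ _ yA zA ne1.
  by exists z.2; rewrite ?inE eqz -surjective_pairing.
apply: leq_trans (leq_imset_card _ _) _.
by apply: leq_trans (max_card _) _; rewrite card_ord.
Qed.

Lemma stab_num_transversal (S : {set T * 'I_k}) : symmetric e ->
  (forall B : {set T}, clique e B -> #|B| <= k) ->
  forces_clique (fun _ : 'I_k => k) e ->
  (forall t, [exists b, (t, b) \in S]) ->
  stab_num block_arc S = k.
Proof.
move=> e_sym e_le e_forces meetS; apply/eqP; rewrite eqn_leq; apply/andP; split.
  by apply/bigmax_leqP => A /andP[_]; apply: stable_block_le.
pose c t := xchoose (existsP (meetS t)).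
have cS t : (t, c t) \in S by apply: (xchooseP (existsP (meetS t))).
have [b [A [cA mA cardA]]] := e_forces c.
have inj : injective (pair^~ b : T -> T * 'I_k) by move=> t u [].
rewrite -[leqLHS]cardA -(card_imset _ inj).
apply: (@leq_bigmax_cond _ _ (fun B : {set T * 'I_k} => #|B|)).
apply/andP; split.
  by apply/subsetP=> _ /imsetP[t tA ->]; rewrite -(mA t tA).
apply/forall_inP=> _ /imsetP[t tA ->]; apply/forall_inP=> _ /imsetP[u uA ->].
apply/implyP; rewrite (inj_eq inj) => ne_tu.
rewrite /block_arc /= eqxx (cA _ _ tA uA ne_tu) (cA _ _ uA tA) 1?eq_sym //.
by rewrite !andbF.
Qed.

(** The rank of the first coordinate strictly increases along arcs. *)
Lemma dipath_block_inj (p : seq (T * 'I_k)) :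
  dipath block_arc p -> {in p &, injective fst}.
Proof.
case: p => // x q /andP[pth _].
pose f (y : T * 'I_k) : nat := enum_rank y.1.
have : uniq (map f (x :: q)).
  apply: (sorted_uniq ltn_trans ltnn).
  by rewrite sorted_map; apply: sub_path pth => y z /andP[].
move=> /(uniqP 0) inj y z yp zp eq1.
have : f y = f z by rewrite /f eq1.
rewrite -{1}(nth_index x yp) -{1}(nth_index x zp) -!(nth_map _ 0) ?index_mem //.
move/inj; rewrite !inE size_map !index_mem => /(_ yp zp) eq_idx.
by rewrite -(nth_index x yp) eq_idx nth_index.
Qed.

End BlockDigraph.

Theorem theorem1 :
  forall k : nat, 0 < k ->
  exists (T : finType) (e : rel T),
    irreflexive e /\
    stab_num e [set: T] = k /\
    forall P : 'I_k.-1 -> seq T,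
      (forall i, dipath e (P i)) ->
      stab_num e [set x | ~~ [exists i, x \in P i]] = k.
Proof.
move=> k k_gt0.
have [T [e [e_sym e_le e_forces]]] :=
  folkman_sum k_gt0 k_gt0 (fun _ : 'I_k => leqnn k) (leqnn _).
exists (T * 'I_k)%type, (block_arc e); split; first exact: block_arc_irr.
split=> [|P pathP]; apply: stab_num_transversal => // t.
  by apply/existsP; exists (Ordinal k_gt0); rewrite inE.
apply: contraT; rewrite negb_exists => /forallP covered.
have cov b : [exists i, (t, b) \in P i].
  by have := covered b; rewrite inE negbK.
(* A path through [(t, b)] is chosen for each colour [b]. No path meets the block of [t] twice, so
   [k] colours would inject into [k - 1] paths. *)
pose f b := xchoose (existsP (cov b)).
have fP b : (t, b) \in P (f b) by apply: (xchooseP (existsP (cov b))).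
have f_inj : injective f.
  move=> b c eq_f; have bP := fP b; rewrite eq_f in bP.
  by have [] := dipath_block_inj (pathP _) bP (fP c) erefl.
have := leq_card f f_inj.
by rewrite !card_ord -ltnS prednK // ltnn.
Qed.
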